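(* Let $1<a<b$ be real numbers. Then $$e^{2(a-b)}\left(\frac{a-1}{b-1}\right)\leq \frac{B(b,b)}{B(a,a)}\leq e^{a-b}\left(\frac{a}{b}\right)^{\frac{1}{2}}.$$
   Context: For real $x,y>0$, $B(x,y)=\int_0^1 t^{x-1}(1-t)^{y-1}\,dt$ denotes the (Euler) beta function. *)

(* Defs.v *)
From mathcomp Require Import all_boot all_order all_algebra.
From mathcomp Require Import all_classical all_reals all_analysis.

Set Implicit Arguments.
Unset Strict Implicit.
Unset Printing Implicit Defensive.

Import Order.TTheory GRing.Theory Num.Theory.
Import numFieldNormedType.Exports.

Local Open Scope classical_set_scope.
Local Open Scope ring_scope.

(* The library's [beta_fun] only takes natural-number parameters.
   For 0 < x < 1 or 0 < y < 1 the improper integral is the Lebesgue integral;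
   the integrand is then unbounded near an endpoint, where [powR] takes the
   irrelevant value 0. *)
Definition Beta (R : realType) (x y : R) : R :=
  \int[@lebesgue_measure R]_(t in `[0, 1]) (t `^ (x - 1) * (1 - t) `^ (y - 1)).

(* Main.v *)
(* With u = 4t(1-t) and J p the integral of u^p over [0,1], one has
   B(x,x) = 4^(1-x) J(x-1), and integrating the derivative of (1-2t) u^(p+1)
   gives (2p+3) J(p+1) = (2p+2) J(p). Since J is convex, this recurrence controls
   J at nearby real exponents, so two local monotonicity statements follow:
   x J(x) is nondecreasing, which with ln 4 <= 2 is the lower bound, and
   e^x sqrt(x) B(x,x) is nonincreasing, which holds because ln 4 >= 7/6, leaving
   enough room over the exponent 1. *)
Require Import Defs.
From mathcomp Require Import all_boot all_order all_algebra.
From mathcomp Require Import all_classical all_reals all_analysis.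
From mathcomp Require Import ring lra.

Import Order.TTheory GRing.Theory Num.Theory.
Import numFieldNormedType.Exports.

Local Open Scope ring_scope.

(** * Real powers *)

(** Young's inequality for the product [v * 1] with conjugate exponents [r] and [r / (r - 1)],
    multiplied by [r]. *)
Lemma powR_bernoulli (R : realType) (v r : R) :
  0 <= v -> 1 <= r -> 1 + r * (v - 1) <= v `^ r.
Proof.
move=> v0; rewrite le_eqVlt => /predU1P[<-|r1].
  by rewrite powRr1// mul1r addrC subrK.
have r0 : 0 < r by lra.
have q0 : 0 < r / (r - 1) by rewrite divr_gt0//; lra.
have rq : r^-1 + (r / (r - 1))^-1 = 1 by rewrite invf_div; field; lra.
have := conjugate_powR v0 ler01 r0 q0 rq.
rewrite mulr1 powR1 mul1r invf_div -(ler_pM2r r0) mulrDl !mulfVK ?gt_eqF//.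
lra.
Qed.

Lemma continuous_normr_powR (R : realType) (p : R) :
  0 <= p -> continuous (fun y : R => `|y| `^ p).
Proof.
rewrite le_eqVlt => /predU1P[<- y|p0 y].
  under eq_fun do rewrite powRr0.
  exact: cvg_cst.
have [->|y0] := eqVneq y 0.
  apply/cvgrPdist_lt => e e0; near=> z.
  rewrite normr0 powR0 ?gt_eqF// sub0r normrN ger0_norm ?powR_ge0//.
  have -> : e = (e `^ p^-1) `^ p.
    by rewrite -powRrM mulVf ?gt_eqF// powRr1// ltW.
  apply: gt0_ltr_powR => //; rewrite ?nnegrE ?powR_ge0//.
  near: z; exists (e `^ p^-1); first exact: powR_gt0.
  by move=> z /=; rewrite sub0r normrN.
apply: (@continuous_comp _ _ _ (fun y : R => `|y|) (fun y => y `^ p)).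
  exact: norm_continuous.
apply: differentiable_continuous; apply/derivable1_diffP.
by apply: derivable_powR; rewrite in_itv/= andbT normr_gt0.
Unshelve. all: end_near. Qed.

(** * The integral of powers of [arch] and its recurrence *)

Definition arch {R : realType} (t : R) : R := 4 * (t * (1 - t)).

(* [powR] of a negative base is the junk value 1; the absolute value makes the
   integrand continuous on the whole line. *)
Definition arch_int {R : realType} (p : R) : R :=
  \int[@lebesgue_measure R]_(t in `[0, 1]) `|arch t| `^ p.

Lemma arch_itv (R : realType) (t : R) : t \in `[0, 1] -> 0 <= arch t <= 1.
Proof.
rewrite in_itv/= /arch => /andP[t0 t1]; have := sqr_ge0 (1 - 2 * t).
by rewrite expr2 => sq0; apply/andP; split; nra.
Qed.

Lemma is_derive_arch (R : realType) (t : R) :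
  is_derive t 1 (@arch R) (4 * (1 - 2 * t)).
Proof.
rewrite /arch; apply: is_derive_eq.
rewrite /GRing.scale/=; ring.
Qed.

Lemma continuous_arch (R : realType) : continuous (@arch R).
Proof.
move=> t; apply: differentiable_continuous; apply/derivable1_diffP.
by have [] := is_derive_arch R t.
Qed.

Lemma continuous_arch_powR (R : realType) (p : R) :
  0 <= p -> continuous (fun t : R => `|arch t| `^ p).
Proof.
move=> p0 t; apply: (@continuous_comp _ _ _ arch (fun y => `|y| `^ p)).
  exact: continuous_arch.
exact: continuous_normr_powR.
Qed.

Lemma continuous_integrable01 {R : realType} {f : R -> R} : continuous f ->
  (@lebesgue_measure R).-integrable `[0, 1]%classic (EFin \o f).
Proof.
move=> cf; apply: continuous_compact_integrable; first exact: segment_compact.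
exact: continuous_subspaceT.
Qed.

Lemma Rintegral01_lin2 (R : realType) (f g : R -> R) (c d : R) :
  continuous f -> continuous g ->
  \int[@lebesgue_measure R]_(t in `[0, 1]) (c * f t + d * g t) =
  c * (\int[@lebesgue_measure R]_(t in `[0, 1]) f t) +
  d * (\int[@lebesgue_measure R]_(t in `[0, 1]) g t).
Proof.
move=> cf cg; rewrite RintegralD//=.
- by rewrite !RintegralZl//; exact: continuous_integrable01.
- by apply: (@continuous_integrable01 R (fun t => c * f t)) => t;
    apply: cvgM; [exact: cvg_cst|exact: cf].
- by apply: (@continuous_integrable01 R (fun t => d * g t)) => t;
    apply: cvgM; [exact: cvg_cst|exact: cg].
Qed.

Lemma arch_int_rec (R : realType) (p : R) : 0 <= p ->
  (2 * p + 3) * arch_int (p + 1) = (2 * p + 2) * arch_int p.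
Proof.
move=> p0.
have p10 : 0 <= p + 1 by lra.
pose F (t : R) := (1 - 2 * t) * `|arch t| `^ (p + 1).
(* The derivative of [F], with [(1 - 2 * t) ^+ 2] replaced by [1 - arch t]. *)
pose f (t : R) := 4 * (p + 1) * `|arch t| `^ p +
  (- (4 * p + 6)) * `|arch t| `^ (p + 1).
have c01 (q c : R) : 0 <= q -> continuous (fun t : R => c * `|arch t| `^ q).
  by move=> q0 t; apply: cvgM; [exact: cvg_cst|exact: continuous_arch_powR].
have cf : continuous f by move=> t; apply: cvgD; exact: c01.
have cF : continuous F.
  move=> t; apply: cvgM; last exact: continuous_arch_powR.
  by apply: cvgB; [exact: cvg_cst|apply: cvgM; [exact: cvg_cst|exact: cvg_id]].
have dF (t : R) : t \in `]0, 1[ -> is_derive t 1 F (f t).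
  rewrite in_itv/= => /andP[t0 t1].
  have at0 : 0 < arch t by rewrite /arch; nra.
  apply: (@near_eq_is_derive R R^o R^o
    (fun x => (1 - 2 * x) * arch x `^ (p + 1)) F).
    have : \forall x \near t, 0 < arch x.
      exact: (cvgr_gt (arch t) (continuous_arch R t) 0 at0).
    by apply: filterS => x x0; rewrite /F gtr0_norm.
  have d1 := is_derive_arch R t.
  have d2 := @is_derive1_powR R (p + 1) _ at0.
  have d3 := is_derive1_comp d2 d1.
  rewrite /f (gtr0_norm at0).
  apply: is_derive_eq.
  rewrite /GRing.scale/= addrK -(@mulr_powRB1 _ (arch t) (p + 1)) ?ltW//; last lra.
  rewrite addrK /arch; ring.
have : \int[@lebesgue_measure R]_(t in `[0, 1]) f t = F 1 - F 0.
  rewrite /Rintegral (@continuous_FTC2 _ f F)//.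
  - exact: continuous_subspaceT.
  - split.
    + by move=> t /dF[].
    + exact/cvg_at_right_filter/cF.
    + exact/cvg_at_left_filter/cF.
  - by move=> t /dF[_ <-]; rewrite derive1E.
have F01 : F 1 - F 0 = 0.
  have p1 : p + 1 != 0 by lra.
  by rewrite /F /arch subrr mul0r !mulr0 normr0 powR0// !mulr0 subrr.
rewrite F01 Rintegral01_lin2; [|exact: continuous_arch_powR..].
rewrite -/(arch_int _) -/(arch_int _); lra.
Qed.

(** * Comparison of different exponents *)

Lemma arch_int_le (R : realType) (p q r c d : R) : 0 <= p -> 0 <= q -> 0 <= r ->
  (forall u, 0 <= u <= 1 -> c * u `^ p + d * u `^ q <= u `^ r) ->
  c * arch_int p + d * arch_int q <= arch_int r.
Proof.
move=> p0 q0 r0 h; rewrite -Rintegral01_lin2; [|exact: continuous_arch_powR..].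
have c01 (s e : R) : 0 <= s -> continuous (fun t : R => e * `|arch t| `^ s).
  by move=> s0 t; apply: cvgM; [exact: cvg_cst|exact: continuous_arch_powR].
apply: le_Rintegral => //.
- by apply: continuous_integrable01 => t; apply: cvgD; exact: c01.
- exact/continuous_integrable01/continuous_arch_powR.
- move=> t t01; have /andP[u0 u1] := arch_itv _ _ t01.
  by apply: h; rewrite ger0_norm// u0.
Qed.

Lemma arch_int0 (R : realType) : arch_int (0 : R) = 1.
Proof.
rewrite /arch_int; under eq_Rintegral do rewrite powRr0.
by rewrite Rintegral_cst//= lebesgue_measure_itv/= lte01 EFinN sube0 mul1r.
Qed.

Lemma arch_int1 (R : realType) : arch_int (1 : R) = 2 / 3.
Proof.
by have := arch_int_rec R 0 (lexx 0); rewrite arch_int0 add0r; lra.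
Qed.

Lemma arch_int_nonincreasing (R : realType) (p q : R) :
  0 <= p -> p <= q -> arch_int q <= arch_int p.
Proof.
move=> p0 pq.
have q0 : 0 <= q by lra.
suff : 1 * arch_int q + 0 * arch_int q <= arch_int p by lra.
apply: arch_int_le => // u /andP[u0 u1]; rewrite mul0r addr0 mul1r.
move: u0; rewrite le_eqVlt => /predU1P[<-|u0]; last by rewrite ger_powR// u0.
move: pq p0; rewrite le_eqVlt => /predU1P[->//|pq p0].
by rewrite powR0 ?powR_ge0// gt_eqF//; lra.
Qed.

(** The recurrence carries positivity from exponent 0 to every natural exponent; monotonicity brings
    it down to [p]. *)
Lemma arch_int_gt0 (R : realType) (p : R) : 0 <= p -> 0 < arch_int p.
Proof.
move=> p0; have pn := archi_boundP p0.
apply: lt_le_trans (arch_int_nonincreasing _ _ _ p0 (ltW pn)).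
elim: (Num.bound p) => [|n IHn]; first by rewrite arch_int0.
have n0 : 0 <= n%:R :> R by [].
have := arch_int_rec R _ n0; rewrite -[n.+1%:R]natr1.
move: n%:R n0 IHn => x x0 Jx rec.
rewrite -(@pmulr_rgt0 _ (2 * x + 3)); last lra.
by rewrite rec mulr_gt0//; lra.
Qed.

(* Convexity of [arch_int], in the extrapolated form that Bernoulli's inequality
   gives pointwise. *)
Lemma arch_int_extrapolate (R : realType) (p s r : R) :
  0 <= p -> 0 < s -> 1 <= r ->
  r * arch_int (p + s) + (1 - r) * arch_int p <= arch_int (p + r * s).
Proof.
move=> p0 s0 r1; have rs0 : 0 < r * s by apply: mulr_gt0 => //; lra.
apply: arch_int_le => [||//|u /andP[u0 _]]; try lra.
rewrite !powRD; [|by rewrite gt_eqF// ltr_wpDl..].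
have := @powR_bernoulli R (u `^ s) r (powR_ge0 _ _) r1.
rewrite -powRrM (mulrC s) => /(ler_wpM2l (powR_ge0 u p)); lra.
Qed.

Lemma Beta_diagE (R : realType) (x : R) : 1 <= x ->
  Beta x x = expR (- ((x - 1) * ln 4)) * arch_int (x - 1).
Proof.
move=> x1; rewrite -RintegralZl//; last first.
  by apply/continuous_integrable01/continuous_arch_powR; lra.
apply: eq_Rintegral => t; rewrite inE/= => t01.
have /andP[u0 _] := arch_itv _ _ t01.
move: t01; rewrite in_itv/= => /andP[t0 t1].
rewrite ger0_norm// /arch powRM//; last by apply: mulr_ge0; lra.
rewrite powRM//; last lra.
by rewrite [4 `^ _]/powR gt_eqF// mulrA -expRD addNr expR0 mul1r.
Qed.

(** * Monotonicity, locally and then globally *)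

(** By convexity the value at [p + s] lies below the chord from [p] to [p + 1], and the recurrence
    gives the ratio of the end values as [1 - (2 * p + 3)^-1]. *)
Lemma arch_int_step_le (R : realType) (p s : R) : 0 <= p -> 0 < s <= 1 ->
  arch_int (p + s) <= (1 - s / (2 * p + 3)) * arch_int p.
Proof.
move=> p0 /andP[s0 s1].
have := @arch_int_extrapolate R p s s^-1 p0 s0.
rewrite mulVf ?gt_eqF// invf_ge1// => /(_ s1).
rewrite -(ler_pM2l s0) mulrDr !mulrA mulrBr mulr1 mulfV ?gt_eqF// mul1r.
have -> : arch_int (p + 1) = (2 * p + 2) / (2 * p + 3) * arch_int p.
  apply: (@mulfI _ (2 * p + 3)); first lra.
  by rewrite arch_int_rec// mulrA mulrCA mulfV ?mulr1//; lra.
have -> : (2 * p + 2) / (2 * p + 3) = 1 - (2 * p + 3)^-1 by field; lra.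
lra.
Qed.

Lemma arch_int_step_ge (R : realType) (x y : R) : 0 < x -> x <= y <= 2 * x ->
  x * arch_int x <= y * arch_int y.
Proof.
move=> x0 /andP[xy y2x]; have y0 : 0 < y by lra.
(* Extrapolating from the exponents 0 and x uses [arch_int x >= 2/3]; for larger
   x, extrapolate from x - 1 and x, whose ratio is known. *)
have [x1|x1] := leP x 1.
  have := @arch_int_extrapolate R 0 x (y / x) (lexx 0) x0.
  rewrite !add0r mulfVK ?gt_eqF// ler_pdivlMr// mul1r => /(_ xy).
  rewrite arch_int0 mulr1 => ineq.
  have J23 : 2 / 3 <= arch_int x.
    by rewrite -arch_int1; apply: arch_int_nonincreasing => //; exact: ltW.
  have {ineq} : y * arch_int x + x - y <= x * arch_int y.
    move: ineq; rewrite -(ler_pM2l x0).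
    have -> : x * (y / x * arch_int x + (1 - y / x)) =
      y * arch_int x + x - y by field; lra.
    by [].
  move=> ineq; rewrite -(ler_pM2l x0).
  (* The second factor is at least [(x + y) * (2 / 3) - y], which is nonnegative exactly when
     [y <= 2 * x]. *)
  have : 0 <= (y - x) * ((x + y) * arch_int x - y).
    by apply: mulr_ge0; [lra|nra].
  have := ler_wpM2l (ltW y0) ineq; lra.
have := @arch_int_extrapolate R (x - 1) 1 (1 + (y - x)).
rewrite mulr1 subrK (_ : x - 1 + (1 + (y - x)) = y); last ring.
have := arch_int_rec R (x - 1); rewrite subrK => rec ext.
have {}ext := ext ltac:(lra) ltac:(lra) ltac:(lra).
have {}rec := rec ltac:(lra).
have {}rec : 2 * x * arch_int (x - 1) = (2 * x + 1) * arch_int x by lra.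
have Jx := arch_int_gt0 R x (ltW x0).
have {ext rec} : (2 * x - (y - x)) * arch_int x <= 2 * x * arch_int y.
  have := ler_wpM2l (ltW x0) ext.
  have -> : x * ((1 + (y - x)) * arch_int x + (1 - (1 + (y - x))) * arch_int (x - 1))
   = x * (1 + (y - x)) * arch_int x - (y - x) / 2 * (2 * x * arch_int (x - 1)) by field.
  rewrite rec; lra.
move=> ineq; rewrite -(@ler_pM2l _ (2 * x)); last lra.
(* After multiplying [ineq] by [y], what remains is [y * (3 * x - y) - 2 * x ^+ 2], which factors as
   [(y - x) * (2 * x - y)]. *)
have : 0 <= (y - x) * (2 * x - y) * arch_int x.
  by rewrite mulr_ge0 ?(ltW Jx)// mulr_ge0; lra.
have := ler_wpM2l (ltW y0) ineq; lra.
Qed.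

(** Finitely many steps of the fixed length [d] lead from [x] past [y], so a comparison of nearby
    points chains into a global one. *)
Lemma ler_of_small_steps (R : realType) (f : R -> R) (m d : R) : 0 < d ->
  (forall x y, m <= x -> x <= y <= x + d -> f x <= f y) ->
  forall x y, m <= x -> x <= y -> f x <= f y.
Proof.
move=> d0 fS x y mx xy.
have [n yn] : exists n, y <= x + n%:R * d.
  exists (Num.bound ((y - x) / d)).
  rewrite -lerBlDl -ler_pdivrMr//; apply/ltW/archi_boundP.
  by apply: divr_ge0; lra.
elim: n => [|n IHn] in x mx xy yn *.
  by rewrite (_ : y = x)// ; apply/le_anti; rewrite xy andbT; lra.
have [yxd|xdy] := leP y (x + d); first by apply: fS => //; rewrite xy.
apply: (@le_trans _ _ (f (x + d))); first by apply: fS => //; lra.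
apply: IHn; [lra..|].
by move: yn; rewrite -natr1; lra.
Qed.

Lemma mul_arch_int_nondecreasing (R : realType) (x y : R) : 0 < x -> x <= y ->
  x * arch_int x <= y * arch_int y.
Proof.
(* Step length [x] is admissible: [x <= y] and [z <= y + x] give [z <= 2 * y]. *)
move=> x0; apply: (@ler_of_small_steps R (fun x => x * arch_int x) x x) => //.
move=> {}y z xy /andP[yz zy]; apply: arch_int_step_ge; lra.
Qed.

(** * Bounds on [ln 4] and the two estimates *)

(** Splitting the exponent into four makes the tangent bound at 0 sufficient: [(17 / 24) ^+ 4] just
    exceeds [1 / 4]. *)
Lemma expR_7_6_le4 (R : realType) : expR (7 / 6 : R) <= 4.
Proof.
have e : (17 / 24 : R) <= expR (- (7 / 24)) by have := expR_ge1Dx (- (7 / 24) : R); lra.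
have -> : 7 / 6 = - (4 * - (7 / 24)) :> R by field.
rewrite expRN expRM_natl -[leRHS]invrK lef_pV2 ?posrE ?exprn_gt0 ?expR_gt0//.
apply: le_trans (lerXn2r 4 _ _ e); rewrite ?nnegrE ?expR_ge0//; lra.
Qed.

Lemma ln4_ge (R : realType) : 7 / 6 <= ln (4 : R).
Proof. by rewrite -(expRK (7 / 6)) ler_ln ?posrE ?expR_gt0// expR_7_6_le4. Qed.

Lemma Beta_diag_gt0 (R : realType) (x : R) : 1 <= x -> 0 < Beta x x.
Proof.
by move=> x1; rewrite Beta_diagE// mulr_gt0 ?expR_gt0// arch_int_gt0//; lra.
Qed.

Lemma ln4_le2 (R : realType) : ln (4 : R) <= 2.
Proof.
have -> : 4 = (1 + 1) ^+ 2 :> R by ring.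
rewrite lnXn ?addr_gt0// mulr2n.
have := @le_ln1Dx R 1; lra.
Qed.

Lemma Beta_diag_mul_expR_sqrt_nonincreasing (R : realType) (x y : R) :
  1 <= x -> x <= y ->
  Beta y y * (expR y * y `^ (1 / 2)) <= Beta x x * (expR x * x `^ (1 / 2)).
Proof.
move=> x1 xy; rewrite -lerN2.
(* Negation turns the claim into an increase; steps have length at most 1, as [arch_int_step_le]
   requires. *)
apply: (@ler_of_small_steps R
  (fun z => - (Beta z z * (expR z * z `^ (1 / 2)))) 1 1) => //.
move=> {x1 xy}x {}y x1 /andP[]; rewrite le_eqVlt => /predU1P[->//|xy yx1].
have x0 : 0 < x by lra.
have y0 : 0 < y by lra.
rewrite lerN2 !Beta_diagE//; last lra.
have := @arch_int_step_le R (x - 1) (y - x).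
rewrite (_ : x - 1 + (y - x) = y - 1); last ring.
move=> /(_ ltac:(lra) ltac:(apply/andP; split; lra)).
have -> : 2 * (x - 1) + 3 = 2 * x + 1 by ring.
have := arch_int_gt0 R (x - 1) ltac:(lra).
move: (arch_int (x - 1)) (arch_int (y - 1)) => Jx Jy Jx0 JyJx.
have {}JyJx : Jy <= expR (- ((y - x) / (2 * x + 1))) * Jx.
  by apply: (le_trans JyJx); rewrite ler_pM2r//; exact: expR_ge1Dx.
rewrite /powR !gt_eqF//.
set L := ln 4; set j := (y - x) / (2 * x + 1).
have -> : expR (- ((x - 1) * L)) * Jx * (expR x * expR (1 / 2 * ln x)) =
    expR (- ((x - 1) * L) + x + 1 / 2 * ln x) * Jx by rewrite !expRD; ring.
apply: (@le_trans _ _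
    (expR (- ((y - 1) * L) + y + 1 / 2 * ln y - j) * Jx)).
  rewrite !expRD.
  have -> : expR (- ((y - 1) * L)) * expR y * expR (1 / 2 * ln y) * expR (- j) * Jx
    = expR (- ((y - 1) * L)) * (expR (- j) * Jx) * (expR y * expR (1 / 2 * ln y)).
    ring.
  by rewrite ler_pM2r ?mulr_gt0 ?expR_gt0// ler_pM2l ?expR_gt0.
(* The remaining comparison of exponents amounts to [(y - x) + (ln y - ln x) / 2 - j <= (y - x) *
   L]. *)
rewrite ler_pM2r// ler_expR.
have lnyx : ln y <= ln x + (y - x) / x.
  have yxE : 1 + (y - x) / x = y / x by field; lra.
  have yx0 : 0 < y / x by rewrite divr_gt0.
  have := @le_ln1Dx R ((y - x) / x); rewrite yxE ln_div ?posrE//; lra.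
(* From [1 <= x], [2 * x * (2 * x + 1)] is at least 6; this [1 / 6] is the excess of [7 / 6] over
   1. *)
have jE : (y - x) / x / 2 - j <= (y - x) / 6.
  have -> : (y - x) / x / 2 - j = (y - x) * (2 * x * (2 * x + 1))^-1.
    by rewrite /j; field; lra.
  by rewrite ler_pM2l ?lef_pV2 ?posrE//; nra.
have := ln4_ge R; rewrite -/L => L76.
have : (y - x) * (7 / 6) <= (y - x) * L by rewrite ler_pM2l//; lra.
lra.
Qed.

Theorem theorem2p5 (R : realType) (a b : R) (ha : 1 < a) (hab : a < b) :
  expR (2 * (a - b)) * ((a - 1) / (b - 1)) <= Beta b b / Beta a a /\
  Beta b b / Beta a a <= expR (a - b) * (a / b) `^ (1 / 2).
Proof.
have a0 : 0 < a by lra.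
have b0 : 0 < b by lra.
have Ba0 := Beta_diag_gt0 R a (ltW ha).
split.
  rewrite ler_pdivlMr// !Beta_diagE; [|lra..].
  have := @mul_arch_int_nondecreasing R (a - 1) (b - 1) ltac:(lra) ltac:(lra).
  rewrite [X in _ <= X -> _]mulrC -ler_pdivrMr; last lra.
  have := arch_int_gt0 R (a - 1) ltac:(lra).
  move: (arch_int (a - 1)) (arch_int (b - 1)) => Ja Jb Ja0 JaJb.
  have -> : expR (2 * (a - b)) * ((a - 1) / (b - 1)) *
      (expR (- ((a - 1) * ln 4)) * Ja) =
    expR (2 * (a - b) - (a - 1) * ln 4) * ((a - 1) * Ja / (b - 1)).
    by rewrite expRD; ring.
  apply: ler_pM => //.
    by apply: divr_ge0; [apply: mulr_ge0|]; lra.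
  (* The exponents compare because [(b - a) * ln 4 <= 2 * (b - a)]. *)
  rewrite ler_expR; have := ln4_le2 R => L2.
  have : (b - a) * ln 4 <= (b - a) * 2 by rewrite ler_pM2l//; lra.
  lra.
have := @Beta_diag_mul_expR_sqrt_nonincreasing R a b (ltW ha) (ltW hab).
have s0 : 0 < expR b * b `^ (1 / 2) by rewrite mulr_gt0 ?expR_gt0 ?powR_gt0.
rewrite ler_pdivrMr// => G; rewrite -(ler_pM2r s0); apply: (le_trans G).
have -> : a `^ (1 / 2) = (a / b) `^ (1 / 2) * b `^ (1 / 2).
  by rewrite -powRM ?divfK ?gt_eqF// ltW// divr_gt0.
have -> : expR a = expR (a - b) * expR b by rewrite -expRD subrK.
by rewrite le_eqVlt; apply/orP; left; apply/eqP; ring.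
Qed.
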